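(* (ZFC) No almost disjoint family $\mathcal{A}\subseteq\wp(\mathbb{N})$ of cardinality $\mathfrak{c}$ has the $\mathfrak{c}$-controlled $\mathbb{R}$-embedding property.
   Context: $\mathfrak{c}$ denotes the cardinality of $\mathbb{R}$. An almost disjoint family is an infinite family of infinite subsets of $\mathbb{N}$ with pairwise finite intersections. For $f:\mathbb{N}\to\mathbb{R}$ and infinite $A\subseteq\mathbb{N}$, $\lim_{n\in A}f(n)$ is the limit along the increasing enumeration of $A$. For a cardinal $\kappa$, an almost disjoint family $\mathcal{A}$ has the $\kappa$-controlled $\mathbb{R}$-embedding property if for every function $\phi:\mathcal{A}\to\mathbb{R}$ there exist $\mathcal{B}\subseteq\mathcal{A}$ of cardinality $\kappa$ and $f:\mathbb{N}\to\mathbb{R}$ such that $\lim_{n\in B}f(n)=\phi(B)$ for every $B\in\mathcal{B}$. *)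

(* Defs.v *)
From HB Require Import structures.
From mathcomp Require Import all_boot all_order all_algebra.
From mathcomp Require Import all_classical all_reals all_analysis.
Import Order.TTheory GRing.Theory Num.Theory.
Import numFieldNormedType.Exports.

Set Implicit Arguments.
Unset Strict Implicit.
Unset Printing Implicit Defensive.

Local Open Scope classical_set_scope.
Local Open Scope ring_scope.
Local Open Scope card_scope.

Definition almost_disjoint_family (A : set (set nat)) : Prop :=
  [/\ infinite_set A,
      (forall X, A X -> infinite_set X) &
      (forall X Y, A X -> A Y -> X <> Y -> finite_set (X `&` Y))].

Definition increasing_enumeration (X : set nat) (e : nat -> nat) : Prop :=
  increasing_seq e /\ range e = X.

(* An infinite X has exactly one increasing enumeration, so the existential
   only names it. *)
Definition cvg_along (R : realType) (f : nat -> R) (X : set nat) (l : R) :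
    Prop :=
  exists2 e : nat -> nat, increasing_enumeration X e &
    (f \o e) @ \oo --> l.

(* The cardinal kappa is represented by any set K of that cardinality.  A
   function on the family A is represented by a total function phi whose
   values outside A are never used. *)
Definition controlled_embedding_property (R : realType) (T : Type) (K : set T)
    (A : set (set nat)) : Prop :=
  forall phi : set nat -> R,
    exists B : set (set nat), exists f : nat -> R,
      [/\ B `<=` A, B #= K & forall X, B X -> cvg_along f X (phi X)].

(* Main.v *)
(** Well-order the continuum in its initial type, so that proper initial
    segments have fewer than continuum many elements, and enumerate along it
    both the members of the family and the functions [nat -> R], of which there
    are also continuum many. Choose [phi X] outside the set of limits along [X]
    of the functions listed before [X]: there are too few of them to fill [R].
    Then a function has limit [phi X] only along those [X] that are not listed
    after it, hence along fewer than continuum many members. *)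

Require Import Defs.
From mathcomp Require Import all_boot all_order all_algebra.
From mathcomp Require Import all_classical all_reals all_analysis.
From mathcomp Require wochoice.
From mathcomp Require Import lra.
Import Order.TTheory GRing.Theory Num.Theory.
Import numFieldNormedType.Exports.

Local Open Scope classical_set_scope.
Local Open Scope ring_scope.
Local Open Scope card_scope.

(** A surrogate for the initial ordinal of [T]. A well-order without large segments serves as it is;
    otherwise it is cut at the least point whose segment is large. *)
Lemma total_rel_small_segments (T : pointedType) :
  exists lt : T -> T -> Prop,
    (forall x y, x <> y -> lt x y \/ lt y x) /\
    (forall x, ~ ([set: T] #<= [set y | lt y x])).
Proof.
have [W wo] := wochoice.well_ordering_principle T.
have least (P : T -> Prop) x : P x ->
    exists2 z, P z & forall y, P y -> W z y.
  move=> Px; have [|z [[Pz zmin] _]] := wo [pred y | `[< P y >]].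
    by exists x; apply/asboolP.
  exists z; first by exact/asboolP.
  by move=> y Py; apply: zmin; apply/asboolP.
have total x y : x <> y -> (W x y /\ x <> y) \/ (W y x /\ y <> x).
  move=> xy; have [|z [->|->] zmin] := least [set x; y] x; first by left.
  - by left; split=> //; apply: zmin; right.
  - by right; split; [apply: zmin; left | apply/nesym].
pose big z : Prop := [set: T] #<= [set y | W y z /\ y <> z].
have [[x /(least big)[x0 bigx0 x0min]]|small] :=
    pselect (exists x, big x); last first.
  exists (fun x y => W x y /\ x <> y); split=> // x bigx.
  by apply: small; exists x.
(* An injection into the least large segment pulls the order back to one
   without large segments. *)
have /pcard_leP[g] := bigx0.
have ginj : injective g by move=> u v; apply: inj; rewrite in_setT.
exists (fun x y => W (g x) (g y) /\ g x <> g y); split.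
  by move=> u v uv; apply: total => /ginj.
move=> u /pcard_leP[h].
have [Wgu gux0] : W (g u) x0 /\ g u <> x0 by exact: (@funS _ _ _ _ g u).
(* A large pulled-back segment below [u] is carried by [g] into the segment below [g u], which is
   then large although [g u] precedes the least such point [x0]. *)
have big_gu : big (g u).
  apply/pcard_leP/injfunPex; exists (g \o h).
    by move=> v _; exact: (@funS _ _ _ _ h v).
  by move=> v w vT wT /ginj; apply: inj.
apply: gux0.
apply: (wochoice.wo_chain_antisymmetric (C := predT) (wochoice.withinW wo)) => //.
by rewrite Wgu x0min.
Qed.

(* The factor [bool] lists every index twice: what is not listed after the
   earlier copy lies strictly before the later one, so that only strict initial
   segments need to be small. *)
Lemma card_lt_diagonal (X I : Type) (U : pointedType) (A : set X)
    (L : I -> X -> U -> Prop) :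
  (forall i x u v, L i x u -> L i x v -> u = v) ->
  A #<= [set: U] -> [set: I * bool] #<= [set: U] ->
  exists phi : X -> U, forall i,
    ~ ([set: U] #<= [set x | A x /\ L i x (phi x)]).
Proof.
move=> Luniq /pcard_injP[a ainj] /pcard_injP[j jinj].
have [lt [total small]] := total_rel_small_segments U.
pose bad x := [set u | exists2 p : I * bool, lt (j p) (a x) & L p.1 x u].
have avoid x : exists u, ~ bad x u.
  apply: contrapT => /forallNP allbad.
  have {}allbad u : bad x u by apply: contrapT; exact: allbad.
  (* If every value were bad, picking for each [u] an index that excludes it would inject [U] into
     the segment below [a x], as an index excludes at most one value at [x]. *)
  apply: (small (a x)).
  have {}allbad u : exists p, lt (j p) (a x) /\ L p.1 x u.
    by have [p ? ?] := allbad u; exists p.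
  have [k kP] := choice allbad.
  apply/pcard_leP/injfunPex; exists (j \o k).
    by move=> u _; case: (kP u).
  move=> u v _ _ /= /jinj; rewrite !in_setT => /(_ erefl erefl) kuv.
  by apply: (Luniq (k u).1 x); [case: (kP u) | rewrite kuv; case: (kP v)].
have [phi phiP] := choice avoid; exists phi => i big.
have [b bP] : exists b, lt (j (i, b)) (j (i, ~~ b)).
  have [|lt01|lt10] := total (j (i, true)) (j (i, false)).
  - by move=> /jinj; rewrite !in_setT => /(_ erefl erefl).
  - by exists true.
  - by exists false.
apply: (small (j (i, ~~ b))); apply: card_le_trans big _.
apply/pcard_leP/injfunPex; exists a; last first.
  by move=> x y /set_mem[Ax _] /set_mem[Ay _]; apply: ainj; exact/mem_set.
move=> x [Ax Lx] /=.
(* Neither copy of [i] precedes [a x]. By totality [a x] then equals the later copy or lies below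
   it, and equality would put the earlier copy before [a x]. *)
have nlt c : ~ lt (j (i, c)) (a x) by move=> h; apply: (phiP x); exists (i, c).
have [|//|/nlt//] := total (a x) (j (i, ~~ b)).
by move=> axE; apply: (nlt b); rewrite axE.
Qed.

Section cantor_series.
Variable R : realType.
Implicit Types X Y : set nat.

(** Base 3 with digits 0 and 1 only: unlike in base 2, distinct digit sequences have distinct
    sums. *)
Definition cantor_term X n : R := if n \in X then 3^-1 ^+ n else 0.
Definition cantor_psum X n : R := \sum_(i < n) cantor_term X i.
Definition cantor_real X : R := sup (range (cantor_psum X)).

(** The added term is the full geometric tail, the sum of [3^-1 ^+ k] over [k >= m]. *)
Lemma cantor_psum_ub X m n :
  cantor_psum X n <= cantor_psum X m + 3^-1 ^+ m * (3 / 2).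
Proof.
have pos k : 0 < 3^-1 ^+ k :> R by rewrite exprn_gt0// invr_gt0.
have term_ge0 k : 0 <= cantor_term X k.
  by rewrite /cantor_term; case: ifP => // _; exact: ltW.
have term_le k : cantor_term X k <= 3^-1 ^+ k.
  by rewrite /cantor_term; case: ifP => // _; exact: ltW.
have [le_mn|/ltnW le_nm] := leqP m n.
  (* With its own tail added, the partial sum is nonincreasing in [n]: the tail drops by exactly
     [3^-1 ^+ n], the most that the new term can contribute. *)
  suff : cantor_psum X n + 3^-1 ^+ n * (3 / 2) <=
         cantor_psum X m + 3^-1 ^+ m * (3 / 2).
    by have := pos n; lra.
  elim: n le_mn => [|n IH]; first by rewrite leqn0 => /eqP ->.
  rewrite leq_eqVlt => /predU1P[->//|]; rewrite ltnS => /IH; apply: le_trans.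
  rewrite {1}/cantor_psum big_ord_recr/= -/(cantor_psum X n) exprS.
  by have := term_le n; lra.
suff : cantor_psum X n <= cantor_psum X m by have := pos m; lra.
elim: m le_nm => [|m IH]; first by rewrite leqn0 => /eqP ->.
rewrite leq_eqVlt => /predU1P[->//|]; rewrite ltnS => /IH /le_trans; apply.
by rewrite [leRHS]/cantor_psum big_ord_recr/= lerDl.
Qed.

Lemma cantor_psum_le X n : cantor_psum X n <= cantor_real X.
Proof.
apply: ub_le_sup; last by exists n.
exists (cantor_psum X 0 + 3^-1 ^+ 0 * (3 / 2)) => _ [k _ <-].
exact: cantor_psum_ub.
Qed.

Lemma cantor_real_le X m :
  cantor_real X <= cantor_psum X m + 3^-1 ^+ m * (3 / 2).
Proof.
apply: ge_sup; first by exists (cantor_psum X 0), 0%N.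
by move=> _ [k _ <-]; exact: cantor_psum_ub.
Qed.

(** At [n] the sum for [X] gains [3^-1 ^+ n], while all later terms for [Y] amount to at most half
    of that. *)
Lemma cantor_real_lt X Y n : (forall i, (i < n)%N -> X i <-> Y i) ->
  X n -> ~ Y n -> cantor_real Y < cantor_real X.
Proof.
move=> XY Xn Yn.
have psumE : cantor_psum X n = cantor_psum Y n.
  apply: eq_bigr => i _; rewrite /cantor_term.
  have /propext XYi := XY i (ltn_ord i).
  by congr (if _ then _ else _); apply: asbool_equiv_eq; rewrite XYi.
have := cantor_real_le Y n.+1; have := cantor_psum_le X n.+1.
rewrite /cantor_psum !big_ord_recr/= -!/(cantor_psum _ n) psumE.
rewrite /cantor_term mem_set// memNset// exprS.
have : 0 < 3^-1 ^+ n :> R by rewrite exprn_gt0// invr_gt0.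
lra.
Qed.

Lemma cantor_real_inj : injective cantor_real.
Proof.
move=> X Y eqXY; apply: contrapT => neqXY.
have ex : exists n, `[< ~ (X n <-> Y n) >].
  apply: contrapT => /forallNP same; apply: neqXY; apply/funext => n.
  by apply: propext; apply: contrapT => nXY; apply: (same n); exact/asboolP.
case: (ex_minnP ex) => n /asboolP nXY nmin.
have agree i : (i < n)%N -> X i <-> Y i.
  by move=> ltin; apply: contrapT => /asboolP/nmin; rewrite leqNgt ltin.
have [Xn|Xn] := pselect (X n); have [Yn|Yn] := pselect (Y n).
- by apply: nXY.
- by have := cantor_real_lt _ _ _ agree Xn Yn; rewrite eqXY ltxx.
- have := cantor_real_lt Y X n (fun i h => iff_sym (agree i h)) Yn Xn.
  by rewrite eqXY ltxx.
- by apply: nXY.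
Qed.

End cantor_series.

(** A sequence is determined by the rational lower cuts of its terms, coded together as one set of
    naturals, which [cantor_real] turns into a real. *)
Lemma card_le_seq_real (R : realType) : [set: nat -> R] #<= [set: R].
Proof.
pose cut (f : nat -> R) :=
  [set pickle p | p in [set p : nat * rat | ratr p.2 < f p.1]].
apply/pcard_injP; exists (@cantor_real R \o cut).
move=> f g _ _ /cantor_real_inj cutE; apply/funext => n.
have cut_le (u v : nat -> R) : cut u `<=` cut v -> u n <= v n.
  move=> uv; rewrite leNgt; apply/negP => /rat_in_itvoo[q].
  rewrite in_itv/= => /andP[vq qu].
  have [|p /= pv /(pcan_inj pickleK) pE] := uv (pickle (n, q)).
    by exists (n, q).
  by move: pv; rewrite pE/= ltNge (ltW vq).
by apply/eqP; rewrite eq_le !cut_le// cutE.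
Qed.

(** The doubled index set of the diagonal argument; the boolean is stored as a 0 or 1 in front of
    the sequence. *)
Lemma card_le_seq_bool_real (R : realType) :
  [set: (nat -> R) * bool] #<= [set: R].
Proof.
apply: card_le_trans (card_le_seq_real R).
apply/pcard_injP.
exists (fun p n => if n is m.+1 then p.1 m else if p.2 then 1 else 0).
move=> [f b] [g c] _ _ /= /funeqP fg; congr (_, _).
  by apply/funext => n; exact: (fg n.+1).
by move: (fg 0%N) => /= /eqP {fg}; case: b; case: c => //=;
  rewrite ?oner_eq0 // eq_sym oner_eq0.
Qed.

(** Writing [e] as [e' \o s] makes [s] strictly increasing on [nat], so [n <= s n] and
    [e' n <= e n]; the roles are then exchanged. *)
Lemma increasing_enumeration_uniq (X : set nat) (e1 e2 : nat -> nat) :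
  increasing_enumeration X e1 -> increasing_enumeration X e2 -> e1 = e2.
Proof.
have le_enum e e' n : increasing_enumeration X e ->
    increasing_enumeration X e' -> (e' n <= e n)%N.
  move=> [emono eX] [e'mono e'X].
  have sub k : exists i, e' i = e k.
    have : X (e k) by rewrite -eX; exists k.
    by rewrite -e'X => -[i _ <-]; exists i.
  have [s sE] := choice sub.
  have smono : {mono s : m k / (m <= k)%N}.
    by move=> m k; have := e'mono (s m) (s k); rewrite !sE emono.
  by rewrite -sE -leEnat e'mono; exact: unstable.mono_leq_infl.
move=> h1 h2; apply/funext => n; apply/eqP.
by rewrite eqn_leq !le_enum.
Qed.

Lemma cvg_along_uniq (R : realType) (f : nat -> R) (X : set nat) (l1 l2 : R) :
  cvg_along f X l1 -> cvg_along f X l2 -> l1 = l2.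
Proof.
move=> [e1 he1 fl1] [e2 he2 fl2].
rewrite (increasing_enumeration_uniq _ _ _ he1 he2) in fl1.
exact: cvg_unique fl1 fl2.
Qed.

Theorem theorem2p6 (R : realType) (A : set (set nat)) :
  almost_disjoint_family A -> A #= [set: R] ->
  ~ controlled_embedding_property R [set: R] A.
Proof.
move=> _ /card_eqPle[AR _] emb.
have [phi phiP] := card_lt_diagonal _ _ _ A (@cvg_along R)
  (@cvg_along_uniq R) AR (card_le_seq_bool_real R).
have [B [f [BA /card_eqPle[_ RB] fB]]] := emb phi.
apply: (phiP f); apply: card_le_trans RB _; apply: subset_card_le.
by move=> X BX; split; [exact: BA | exact: fB].
Qed.
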